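(* For $t\ge 0$ put $$\lambda_t=(10\cdot2^t-1,\;10\cdot2^t-1,\;2^{t+2}-1,\;2^{t+1}-1),\qquad d_t=|\lambda_t|=26\cdot 2^t-4.$$ For every $t\ge0$, the ordered monomial $$x^{\lambda_t}=x_1^{10\cdot2^t-1}x_2^{10\cdot2^t-1}x_3^{2^{t+2}-1}x_4^{2^{t+1}-1}$$ is hit in $P(4)$, and the monomial symmetric function $m_{\lambda_t}$ is hit in $B(4)$. Moreover, $\omega(\lambda_t)>_l\omega_{\min}(d_t)$ for every $t\ge0$.
   Context: $P(4)=\mathbf F_2[x_1,\dots,x_4]$, $|x_i|=1$; the total Steenrod square $\mathrm{Sq}=\sum_r\mathrm{Sq}^r$ is the algebra endomorphism with $\mathrm{Sq}(x_i)=x_i+x_i^2$. $\Sigma_4$ permutes the variables and $B(4)=P(4)^{\Sigma_4}$. For $M=P(4)$ or $B(4)$, an element of $M^d$ is hit in $M$ if it lies in $\mathcal H^d(M)=\sum_{r>0}\mathrm{Sq}^r(M^{d-r})$. For a partition $\lambda$ with at most four positive parts, $m_\lambda\in B(4)$ is the sum of the distinct monomials in the $\Sigma_4$-orbit of $x_1^{\lambda_1}\cdots x_4^{\lambda_4}$. For $a\in\mathbf N^4$ with $a_i=\sum_{j\ge1}a_{ij}2^{j-1}$, $a_{ij}\in\{0,1\}$, set $\omega(a)=(\omega_1,\omega_2,\dots)$ with $\omega_j=\sum_i a_{ij}$. Weight sequences are compared in the left lexicographic order $<_l$ (first differing entry from the left, with trailing zeros appended as needed). A spike is a monomial all of whose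 exponents have the form $2^r-1$, $r\ge0$; $\omega_{\min}(d)$ denotes the $<_l$-least weight sequence among the degree-$d$ spikes in $P(4)$. *)

(* Defs.v *)
From mathcomp Require Import all_boot all_fingroup all_algebra.
From mathcomp Require Import mpoly.

Set Implicit Arguments.
Unset Strict Implicit.
Unset Printing Implicit Defensive.

Import GRing.Theory.

Local Open Scope ring_scope.

Definition Sq (n : nat) (p : {mpoly 'F_2[n]}) : {mpoly 'F_2[n]} :=
  p \mPo [tuple 'X_i + 'X_i ^+ 2 | i < n].

(* On a homogeneous p of degree e, Sq^r p is the component of degree e + r of
   Sq p; the sum over e extends this linearly to all polynomials. *)
Definition Sqr (n r : nat) (p : {mpoly 'F_2[n]}) : {mpoly 'F_2[n]} :=
  \sum_(e < msize p) pihomog mdeg (e + r) (Sq (pihomog mdeg e p)).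

Definition P (n : nat) : {pred {mpoly 'F_2[n]}} := predT.

Definition B (n : nat) : {pred {mpoly 'F_2[n]}} :=
  [pred p | p \is symmetric].

Arguments P n _ : clear implicits.
Arguments B n _ : clear implicits.

(* f lies in the sum over r > 0 of the images Sq^r (M^(d-r)), where M^e is the
   set of elements of M that are homogeneous of degree e; M^(d-r) is zero for
   r > d. *)
Definition hit (n : nat) (M : {pred {mpoly 'F_2[n]}}) (d : nat)
    (f : {mpoly 'F_2[n]}) : Prop :=
  exists g : nat -> {mpoly 'F_2[n]},
    (forall r : nat, (0 < r <= d)%N -> g r \in M /\ g r \is (d - r).-homog) /\
    f = \sum_(1 <= r < d.+1) Sqr r (g r).

Definition monomial_sym (n : nat) (a : 'X_{1..n}) : {mpoly 'F_2[n]} :=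
  \sum_(b <- undup [seq [multinom a (s i) | i < n] | s : 'S_n]) 'X_[b].

(* Entries are indexed from j = 0: [weight a j] is omega_{j+1}(a), the number of
   exponents with binary digit 1 at 2^j. Infinite sequences make the padding
   with trailing zeros automatic. *)
Definition weight (n : nat) (a : 'X_{1..n}) (j : nat) : nat :=
  (\sum_(i < n) odd (a i %/ 2 ^ j))%N.

Definition lex_lt (v w : nat -> nat) : Prop :=
  exists j : nat, (forall k : nat, (k < j)%N -> v k = w k) /\ (v j < w j)%N.

Definition spike (n : nat) (a : 'X_{1..n}) : Prop :=
  forall i : 'I_n, exists r : nat, a i = (2 ^ r - 1)%N.

Definition is_weight_min (n d : nat) (w : nat -> nat) : Prop :=
  (exists a : 'X_{1..n}, [/\ spike a, mdeg a = d & weight a =1 w]) /\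
  (forall b : 'X_{1..n}, spike b -> mdeg b = d ->
     weight b =1 w \/ lex_lt w (weight b)).

Definition lambda (t : nat) : 'X_{1..4} :=
  [multinom of [:: 10 * 2 ^ t - 1; 10 * 2 ^ t - 1; 2 ^ (t + 2) - 1;
                   2 ^ (t + 1) - 1]%N].

Definition d_ (t : nat) : nat := (26 * 2 ^ t - 4)%N.

(* Main.v *)
From HB Require Import structures.
Require Import Defs.
From mathcomp Require Import all_boot all_fingroup all_algebra.
From mathcomp Require Import mpoly.
From mathcomp Require Import zify ring.

(* The exponents satisfy lambda_(t+1) = 2 lambda_t + 1 and
   lambda_0 = 2 (4,4,1,0) + 1, and x^(4,4,1,0) = Sq^4 x^(2,2,1,0). Hence both
   hit statements reduce to a study of c (Sq^r g)^2, c the product of the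
   variables. With chi the antipode, c Sq^(2r)(g^2) is chi(Sq^(2r))(c) g^2 modulo
   hits. Writing chi(Sq)(x) = x + chi(Sq)(x)^2, the factor chi(Sq^(2r))(c) is a
   sum over proper subsets S of the variables of x_S times a square, and
   x_S y^2 = x_S Sq^e(y), e = deg y, is chi(Sq^e)(x_S) y modulo hits. What is left
   vanishes: in degrees 2 d_t + 4 because d_t + 3 is not a sum of two powers of 2,
   and for lambda_0 because every monomial of the sum occurs twice. All these
   expressions are equivariant, so the argument works in P and in B at once.
   The least weight is that of the spike with exponents
   16.2^t - 1, 8.2^t - 1, 2^t - 1, 2^t - 1. *)

Set Implicit Arguments.
Unset Strict Implicit.
Unset Printing Implicit Defensive.

Import GRing.Theory.

Local Open Scope ring_scope.

(** * Steenrod squares as coefficients of a total square with a degree parameter T *)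

Section TotalSquare.
Context (n : nat).
Local Notation R := {mpoly 'F_2[n]}.

Lemma pchar2_mpoly : 2%N \in [pchar R].
Proof. by apply: (rmorph_pchar (@mpolyC n 'F_2)); apply: pchar_Fp. Qed.

Lemma pchar2_poly : 2%N \in [pchar {poly R}].
Proof. exact: (rmorph_pchar (@polyC R) pchar2_mpoly). Qed.

Lemma sqr_sum_pchar2 (S : comNzRingType) (I : Type) (s : seq I) (Q : pred I)
    (F : I -> S) : 2%N \in [pchar S] ->
  (\sum_(i <- s | Q i) F i) ^+ 2 = \sum_(i <- s | Q i) F i ^+ 2.
Proof. by move=> ch; rewrite -(pFrobenius_autE ch) rmorph_sum. Qed.

Lemma dhomogXi i : 'X_i \is [in 'F_2[n], 1.-homog].
Proof. by rewrite dhomogX /= mdeg1. Qed.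

(* Sq with a parameter T = 'X recording the increase in degree. *)
Definition Sqt : R -> {poly R} :=
  mmap (polyC \o @mpolyC n 'F_2) (fun i => ('X_i)%:P + ('X_i ^+ 2)%:P * 'X).

HB.instance Definition _ := GRing.RMorphism.on Sqt.

Lemma SqtX i : Sqt 'X_i = ('X_i)%:P + ('X_i ^+ 2)%:P * 'X.
Proof. by rewrite /Sqt mmapX mmap1U. Qed.

Lemma SqtXm m : Sqt 'X_[m] = \prod_i (('X_i)%:P + ('X_i ^+ 2)%:P * 'X) ^+ m i.
Proof. by rewrite /Sqt mmapX. Qed.

Lemma SqtZ c p : Sqt (c *: p) = c%:MP%:P * Sqt p.
Proof. by rewrite /Sqt mmapZ. Qed.

(* Homogeneous of degree k once the parameter 'X has degree -1. *)
Definition graded k (q : {poly R}) := forall a, q`_a \is (a + k).-homog.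

Lemma graded1 : graded 0 1.
Proof.
by move=> [|a]; rewrite coef1 /= ?dhomog1 ?dhomog0.
Qed.

Lemma gradedD k p q : graded k p -> graded k q -> graded k (p + q).
Proof. by move=> hp hq a; rewrite coefD dhomogD. Qed.

Lemma gradedM k l p q : graded k p -> graded l q -> graded (k + l) (p * q).
Proof.
move=> hp hq a; rewrite coefM; apply: rpred_sum => -[j hj] _ /=.
have -> : (a + (k + l) = (j + k) + (a - j + l))%N by lia.
exact: dhomogM.
Qed.

Lemma graded_prod (I : Type) (s : seq I) (Q : pred I) k p :
  (forall i, Q i -> graded (k i) (p i)) ->
  graded (\sum_(i <- s | Q i) k i) (\prod_(i <- s | Q i) p i).
Proof.
move=> h; elim/big_rec2: _ => [|i x y Qi]; first exact: graded1.
by apply: gradedM; apply: h.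
Qed.

Lemma graded_exp k p e : graded k p -> graded (k * e) (p ^+ e).
Proof.
move=> hp; elim: e => [|e IH]; first by rewrite muln0; apply: graded1.
by rewrite exprS mulnS; apply: gradedM.
Qed.

Lemma gradedC k c : c \is k.-homog -> graded k c%:P.
Proof. by move=> hc [|a]; rewrite coefC /= ?dhomog0. Qed.

Lemma graded_Sqt e p : p \is e.-homog -> graded e (Sqt p).
Proof.
move=> hp a; rewrite [p]mpolyE raddf_sum /= coef_sum big_seq.
apply: rpred_sum => m hm; rewrite SqtZ coefCM mul_mpolyC.
apply: rpredZ; move: a; have <- : mdeg m = e := dhomog_mf hp hm.
rewrite SqtXm mdegE.
apply: graded_prod => i _; rewrite -{1}[m i]mul1n; apply: graded_exp.
apply: gradedD; first by apply: gradedC; exact: dhomogXi.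
move=> [|[|a]]; rewrite coefMX coefC ?dhomog0 //=.
exact: (dhomogMn 2 (dhomogXi i)).
Qed.

Lemma horner1_Sqt p : (Sqt p).[1] = Sq p.
Proof.
rewrite [p]mpolyE /Sq !raddf_sum /= horner_sum.
apply: eq_bigr => m _; rewrite comp_mpolyZ comp_mpolyX SqtZ hornerM.
rewrite hornerC mul_mpolyC SqtXm horner_prod; congr (_ *: _).
apply: eq_bigr => i _; rewrite tnth_mktuple horner_exp; congr (_ ^+ _).
by rewrite hornerD hornerMX !hornerC mulr1.
Qed.

(** Setting T = 1 gives back [Sq], and no information is lost on homogeneous p: the coefficient of
    T^a sits in degree a + e, so taking components recovers the coefficients. *)
Lemma pihomog_Sq e r p : p \is e.-homog ->
  pihomog mdeg (e + r) (Sq p) = (Sqt p)`_r.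
Proof.
move=> hp; have hq := graded_Sqt hp.
(* Padding the range by r + 1 makes the index r available even beyond the size. *)
rewrite -horner1_Sqt (horner_coef_wide _ (leq_addr r.+1 (size (Sqt p)))).
rewrite raddf_sum (bigD1 (Ordinal (ltn_addl _ (ltnSn r)))) //= big1 => [|i].
  by rewrite expr1n mulr1 addr0 pihomog_dE // (addnC e) hq.
rewrite -val_eqE /= => ne; rewrite expr1n mulr1.
by rewrite (pihomog_ne0 (d := (i + e)%N)) ?hq // addnC eqn_add2l.
Qed.

(** Since [Sqt] is a ring morphism, additivity and the Cartan formula for Sq^r become addition and
    multiplication of polynomials in T. *)
Lemma SqrE r (p : R) : Sqr r p = (Sqt p)`_r.
Proof.
rewrite [in RHS](pihomog_partitionE (mf := mdeg) (leqnn (msize p))).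
rewrite raddf_sum coef_sum; apply: eq_bigr => e _.
by rewrite pihomog_Sq ?pihomogP.
Qed.

Lemma Sqr0p (p : R) : Sqr 0 p = p.
Proof.
rewrite SqrE -horner_coef0 [p]mpolyE !raddf_sum /= horner_sum.
apply: eq_bigr => m _; rewrite SqtZ hornerM hornerC mul_mpolyC SqtXm horner_prod.
rewrite [in RHS]mpolyXE_id; congr (_ *: _); apply: eq_bigr => i _.
by rewrite horner_exp hornerD hornerMX !hornerC mulr0 addr0.
Qed.

Lemma SqrD r (p q : R) : Sqr r (p + q) = Sqr r p + Sqr r q.
Proof. by rewrite !SqrE raddfD coefD. Qed.

Lemma Sqrr0 r : Sqr r (0 : R) = 0.
Proof. by rewrite SqrE raddf0 coef0. Qed.

Lemma Sqr_sum (I : Type) (s : seq I) (Q : pred I) r (F : I -> R) :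
  Sqr r (\sum_(i <- s | Q i) F i) = \sum_(i <- s | Q i) Sqr r (F i).
Proof. by rewrite SqrE raddf_sum coef_sum; apply: eq_bigr => i _; rewrite SqrE. Qed.

Lemma Sqr_homog e r (p : R) : p \is e.-homog -> Sqr r p \is (r + e).-homog.
Proof. by move=> hp; rewrite SqrE; apply: graded_Sqt. Qed.

Lemma pihomog_Sqr d r (p : R) :
  pihomog mdeg d (Sqr r p) =
  if (r <= d)%N then Sqr r (pihomog mdeg (d - r) p) else 0.
Proof.
rewrite {1}(pihomog_partitionE (mf := mdeg) (leq_addr d.+1 (msize p))).
rewrite Sqr_sum raddf_sum /=; case: leqP => h.
  have h' : (d - r < msize p + d.+1)%N by lia.
  rewrite (bigD1 (Ordinal h')) //= big1 => [|i].
    have := Sqr_homog r (pihomogP mdeg (d - r) p); rewrite subnKC // => hd.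
    by rewrite addr0 pihomog_dE.
  rewrite -val_eqE /= => ne; apply: (pihomog_ne0 (d := (r + i)%N)).
    by move: ne; apply: contraNneq => /eqP; lia.
  by rewrite Sqr_homog ?pihomogP.
rewrite big1 // => i _; apply: (pihomog_ne0 (d := (r + i)%N)).
  by apply/eqP; lia.
by rewrite Sqr_homog ?pihomogP.
Qed.

Lemma mpoly_sqrE (p : R) : p ^+ 2 = \sum_(m <- msupp p) p@_m *: 'X_[m] ^+ 2.
Proof.
rewrite {1}[p]mpolyE sqr_sum_pchar2 ?pchar2_mpoly //; apply: eq_bigr => m _.
rewrite exprZn; congr (_ *: _).
(* Each coefficient is 0 or 1, hence equal to its square. *)
by case: (p@_m) => [[|[|k]] hk]; apply/val_inj.
Qed.

Lemma coefM_top (p q : {poly R}) d e :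
  (size p <= d.+1)%N -> (size q <= e.+1)%N ->
  (size (p * q)%R <= (d + e).+1)%N /\ (p * q)`_(d + e) = p`_d * q`_e.
Proof.
move=> hp hq; split; first by apply: leq_trans (size_polyMleq _ _) _; lia.
rewrite coefM (bigD1 (Ordinal (leq_addr e d : d < (d + e).+1)%N)) //=.
rewrite addKn big1 ?addr0 // => -[i hi]; rewrite -val_eqE /= => ne.
have [hid|hid] := leqP i d; last by rewrite [p`_i]nth_default ?mul0r ?(leq_trans hp).
rewrite [X in _ * X]nth_default ?mulr0 //; apply: leq_trans hq _.
by move: ne; rewrite neq_ltn; lia.
Qed.

(** Each factor x + x^2 T has T-degree at most 1 with coefficient x^2 there, so the coefficient in
    the largest possible T-degree is the product of the x^2. *)
Lemma SqrX_top m : Sqr (mdeg m) ('X_[m] : R) = 'X_[m] ^+ 2.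
Proof.
rewrite SqrE SqtXm mdegE mpolyXE_id -prodrXl.
pose b (i : 'I_n) : {poly R} := ('X_i)%:P + ('X_i ^+ 2)%:P * 'X.
have hb i : (size (b i) <= 2)%N /\ (b i)`_1 = 'X_i ^+ 2.
  split; last by rewrite coefD coefC coefMX coefC /= add0r.
  apply: leq_trans (size_polyD _ _) _; rewrite geq_max size_polyC.
  rewrite (leq_trans (leq_b1 _)) // (leq_trans (size_polyMleq _ _)) //.
  by rewrite size_polyX size_polyC; case: (_ != _).
pose G i := b i ^+ m i.
have hG i : (size (G i) <= (m i).+1)%N /\ (G i)`_(m i) = ('X_i ^+ m i) ^+ 2.
  rewrite {}/G; elim: (m i) => [|k [IH1 IH2]].
    by rewrite !expr0 size_poly1 coef1 expr1n.
  have [hb1 hb2] := hb i; have := coefM_top hb1 IH1.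
  by rewrite add1n -!exprS IH2 hb2 -exprMn -exprS.
suff [] : (size (\prod_i G i)%R <= (\sum_i m i).+1)%N /\
   (\prod_i G i)`_(\sum_i m i) = \prod_i ('X_i ^+ m i) ^+ 2 by [].
elim/big_rec3: _ => [|i x y z _ [h1 h2]]; first by rewrite size_poly1 coef1.
have [hi1 hi2] := hG i; have [h3 h4] := coefM_top hi1 h1.
by split=> //; rewrite h4 h2 hi2.
Qed.

Lemma Sqr_top e (p : R) : p \is e.-homog -> Sqr e p = p ^+ 2.
Proof.
move=> hp; rewrite mpoly_sqrE {1}[p]mpolyE Sqr_sum [in LHS]big_seq [in RHS]big_seq.
apply: eq_bigr => m hm; rewrite SqrE SqtZ coefCM mul_mpolyC -SqrE.
by have <- : mdeg m = e := dhomog_mf hp hm; rewrite SqrX_top.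
Qed.

End TotalSquare.

(** * The antipode and the chi-trick *)

Section ChiTrick.
Context (n : nat).
Local Notation R := {mpoly 'F_2[n]}.

(* The T-linear extension of Sqt. *)
Definition Sqe : {poly R} -> {poly R} := horner_eval 'X \o map_poly (@Sqt n).

HB.instance Definition _ := GRing.RMorphism.on Sqe.

Lemma SqeC c : Sqe c%:P = Sqt c.
Proof. by rewrite /Sqe /= map_polyC horner_evalE hornerC. Qed.

Lemma SqeX : Sqe 'X = 'X.
Proof. by rewrite /Sqe /= map_polyX horner_evalE hornerX. Qed.

Lemma coef_Sqe q m : (Sqe q)`_m = \sum_(a < m.+1) Sqr a q`_(m - a).
Proof.
rewrite /Sqe /= horner_evalE.
have hs := leq_trans (size_poly _ _ : (size (map_poly (@Sqt n) q) <= size q)%N)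
  (leq_addl m.+1 (size q)).
rewrite (horner_coef_wide _ hs) coef_sum big_split_ord /= [X in _ + X]big1 ?addr0.
  rewrite [RHS](reindex_inj rev_ord_inj); apply: eq_bigr => -[i hi] _ /=.
  by rewrite coefMXn ltnNge -ltnS hi /= coef_map SqrE subSS subKn.
by move=> i _; rewrite coefMXn ifT //; lia.
Qed.

(* The antipode chi(Sq) on a variable, truncated: Sqe sends it to 'X_i modulo
   T^(2^N - 1). *)
Definition conjSq N (i : 'I_n) : {poly R} :=
  \sum_(k < N) ('X_i ^+ (2 ^ k))%:P * 'X^(2 ^ k - 1).

(** The truncated form of chi(Sq)(x) = x + T chi(Sq)(x)^2: squaring is termwise in characteristic 2,
    and 2(2^k - 1) + 1 = 2^(k+1) - 1. *)
Lemma uS N i : conjSq N.+1 i = ('X_i)%:P + 'X * conjSq N i ^+ 2.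
Proof.
rewrite /conjSq big_ord_recl /= expr0 mulr1 expr1; congr (_ + _).
rewrite sqr_sum_pchar2 ?pchar2_poly // mulr_sumr; apply: eq_bigr => k _.
rewrite /bump /= add1n exprMn -rmorphXn -!exprM mulrCA -exprS expnSr; congr (_ * 'X^_).
have : (0 < 2 ^ k)%N by rewrite expn_gt0.
set a := (2 ^ k)%N; lia.
Qed.

(** Induction through [uS]: the term x^2 T of [Sqt] on x cancels against T times the square of x, so
    only the error term survives, with its exponents updated. *)
Lemma Sqe_u N i : Sqe (conjSq N i) = ('X_i)%:P + ('X_i ^+ (2 ^ N))%:P * 'X^(2 ^ N - 1).
Proof.
elim: N => [|N IH].
  by rewrite /conjSq big_ord0 raddf0 expr0 mulr1 expr1 addrr_pchar2 ?pchar2_poly.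
rewrite uS raddfD /= rmorphM rmorphXn /= IH SqeX SqeC SqtX.
have -> : (('X_i)%:P + ('X_i ^+ (2 ^ N))%:P * 'X^(2 ^ N - 1)) ^+ 2 =
    (('X_i)%:P ^+ 2 + (('X_i ^+ (2 ^ N))%:P * 'X^(2 ^ N - 1)) ^+ 2 : {poly R}).
  exact: (pFrobenius_autD_comm (pchar2_poly n) (mulrC _ _)).
rewrite -rmorphXn mulrDr [_ * 'X]mulrC -addrA [X in _ + X]addrA.
rewrite addrr_pchar2 ?pchar2_poly // add0r exprMn -rmorphXn -!exprM mulrCA -exprS expnSr.
congr (_ + _ * 'X^_).
have : (0 < 2 ^ N)%N by rewrite expn_gt0.
set a := (2 ^ N)%N; lia.
Qed.

(** The term a = 0 is chi(Sq^m) of the product of variables, times h; the terms with a > 0 will be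
    hits. The bound on m keeps the truncation error out of the coefficient considered. *)
Lemma chi_trick N (Q : pred 'I_n) m (h : R) : (m < 2 ^ N - 1)%N ->
  (\prod_(i | Q i) 'X_i) * Sqr m h =
  \sum_(a < m.+1) Sqr a ((\prod_(i | Q i) conjSq N i)`_(m - a) * h).
Proof.
move=> hm.
(* The same coefficient is computed by convolution, and by multiplicativity of [Sqe] modulo T^(2^N -
   1). *)
transitivity (Sqe ((\prod_(i | Q i) conjSq N i) * h%:P))`_m; last first.
  by rewrite coef_Sqe; apply: eq_bigr => a _; rewrite coefMC.
rewrite rmorphM rmorph_prod /= SqeC.
have [v ->] : exists v, \prod_(i | Q i) Sqe (conjSq N i) =
    (\prod_(i | Q i) 'X_i)%:P + v * 'X^(2 ^ N - 1).
  elim/big_ind2: _ => [|x p y q [v ->] [w ->]|i _].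
  - by exists 0; rewrite mul0r addr0.
  - exists (v * y%:P + w * x%:P + v * w * 'X^(2 ^ N - 1)).
    rewrite polyCM; ring.
  - by exists ('X_i ^+ (2 ^ N))%:P; rewrite Sqe_u.
by rewrite mulrDl coefD coefCM -mulrA ['X^_ * _]mulrC mulrA coefMXn hm addr0 SqrE.
Qed.

End ChiTrick.

(** * Closure properties of hit elements, for P and B together *)

Section Hits.
Context (n : nat).
Local Notation R := {mpoly 'F_2[n]}.

(** What [P n] and [B n] have in common, so that each hit argument is made once: the coefficients
    produced by the chi-trick are symmetric and may multiply elements of M. *)
Definition graded_sym_module (M : {pred R}) : Prop :=
  [/\ {in M &, forall p q, p + q \in M}, {in M &, forall p q, p * q \in M},
      {subset symmetric <= M} & forall d, {in M, forall p, pihomog mdeg d p \in M}].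

Lemma graded_sym_moduleP : graded_sym_module (P n).
Proof. by []. Qed.

Lemma graded_sym_moduleB : graded_sym_module (B n).
Proof.
split=> [p q|p q|p|d p]; rewrite !inE.
- exact: rpredD.
- exact: rpredM.
- by [].
- exact: pihomog_sym.
Qed.

Context (M : {pred R}) (d : nat) (hM : graded_sym_module M).

Lemma sym_in p : p \is symmetric -> p \in M.
Proof. by case: hM => _ _ h _; apply: h. Qed.

Lemma hit0 : hit M d 0.
Proof.
exists (fun=> 0); split=> [r _|]; first by rewrite sym_in ?rpred0 ?dhomog0.
by rewrite big1 // => r _; rewrite Sqrr0.
Qed.

Lemma hitD f1 f2 : hit M d f1 -> hit M d f2 -> hit M d (f1 + f2).
Proof.
case: hM => hD _ _ _.
move=> [g1 [h1 ->]] [g2 [h2 ->]]; exists (fun r => g1 r + g2 r); split=> [r hr|].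
  by have [[? ?] [? ?]] := (h1 r hr, h2 r hr); rewrite hD ?dhomogD.
by rewrite -big_split; apply: eq_bigr => r _; rewrite SqrD.
Qed.

Lemma hit_sum (I : Type) (s : seq I) (Q : pred I) F :
  (forall i, Q i -> hit M d (F i)) -> hit M d (\sum_(i <- s | Q i) F i).
Proof.
by move=> h; elim/big_ind: _ => //; [exact: hit0|exact: hitD].
Qed.

Lemma hit_pihomog_sum (I : Type) (s : seq I) (Q : pred I) F :
  (forall i, Q i -> hit M d (pihomog mdeg d (F i))) ->
  hit M d (pihomog mdeg d (\sum_(i <- s | Q i) F i)).
Proof. by move=> h; rewrite raddf_sum; apply: hit_sum. Qed.

(** Projecting onto degree d afterwards allows an inhomogeneous p, so the summands of the chi-trick
    need no separate degree bookkeeping. *)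
Lemma hit_Sqr a p : (0 < a)%N -> p \in M -> hit M d (pihomog mdeg d (Sqr a p)).
Proof.
case: hM => _ _ _ hpi a_gt0 pM; rewrite pihomog_Sqr; case: leqP => had; last exact: hit0.
exists (fun r => if r == a then pihomog mdeg (d - a) p else 0); split=> [r _|].
  case: eqP => [->|_]; last by rewrite sym_in ?rpred0 ?dhomog0.
  by rewrite hpi ?pihomogP.
rewrite (bigD1_seq a) ?iota_uniq ?mem_index_iota ?a_gt0 //= eqxx big1 ?addr0 //.
by move=> r /negPf->; rewrite Sqrr0.
Qed.

End Hits.

(** * Hits of the form c (Sq^r g)^2, c the product of all variables *)

Section Kameko.
Context (n : nat).
Local Notation R := {mpoly 'F_2[n]}.

Lemma coef_sqr_pchar2 (p : {poly R}) m :
  (p ^+ 2)`_m = if odd m then 0 else p`_m./2 ^+ 2.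
Proof.
rewrite -[p in LHS]coefK poly_def sqr_sum_pchar2 ?pchar2_poly // coef_sum.
under eq_bigr => i _ do rewrite exprZn -exprM coefZ coefXn.
case: ifP => hm.
  rewrite big1 // => i _; case: eqP => [h|_]; last by rewrite mulr0.
  by move: hm; rewrite h oddM andbF.
have hm2 : m = (m./2 * 2)%N by rewrite muln2 -[LHS](odd_double_half m) hm.
case: (ltnP m./2 (size p)) => hs; last first.
  rewrite nth_default // expr0n /= big1 // => i _; rewrite hm2 eqn_pmul2r //.
  by rewrite gtn_eqF ?mulr0 // (leq_trans (ltn_ord i)).
rewrite (bigD1 (Ordinal hs)) //= big1 ?addr0 => [|i].
  by rewrite -hm2 eqxx mulr1.
by rewrite -val_eqE /= eq_sym [in m == _]hm2 eqn_pmul2r // => /negPf ->; rewrite mulr0.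
Qed.

Lemma Sqr_sqr r (g : R) : Sqr r.*2 (g ^+ 2) = Sqr r g ^+ 2.
Proof. by rewrite !SqrE rmorphXn coef_sqr_pchar2 odd_double doubleK. Qed.

Lemma graded_u N i : graded 1 (@conjSq n N i).
Proof.
rewrite /conjSq => a; rewrite coef_sum; apply: rpred_sum => k _.
rewrite coefCM coefXn; case: eqP => [->|_]; last by rewrite mulr0 dhomog0.
have : (0 < 2 ^ k)%N by rewrite expn_gt0.
rewrite mulr1 => /subnK->; have := dhomogMn (2 ^ k) (dhomogXi i).
by rewrite mul1n.
Qed.

Lemma graded_prod_u N (Q : pred 'I_n) : graded #|Q| (\prod_(i | Q i) conjSq N i).
Proof.
by rewrite -sum1_card; apply: graded_prod => i _; apply: graded_u.
Qed.

Lemma map_msym_u N (s : 'S_n) i : map_poly (msym s) (conjSq N i) = @conjSq n N (s i).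
Proof.
rewrite /conjSq raddf_sum; apply: eq_bigr => k _ /=.
by rewrite rmorphM /= map_polyXn map_polyC /= rmorphXn /= /msym mmapX mmap1U.
Qed.

Lemma msym_coef_prod_u N (s : 'S_n) (Q Q' : pred 'I_n) a :
  (forall i, Q' (s i) = Q i) ->
  msym s (\prod_(i | Q i) conjSq N i)`_a = (\prod_(i | Q' i) conjSq N i)`_a :> R.
Proof.
move=> h; rewrite -coef_map rmorph_prod /= [in RHS](reindex_inj (@perm_inj _ s)) /=.
by under eq_bigr => i _ do rewrite map_msym_u; under [in RHS]eq_bigl => i do rewrite h.
Qed.

(* The coefficient of g that remains in kameko_hit after removing hits, for
   the subsets J of size n - c. *)
Definition split_sum N c a b : R :=
  \sum_(J : {set 'I_n} | (#|J| + c == n)%N)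
    (\prod_(i in J) conjSq N i)`_a * (\prod_(i | i \notin J) conjSq N i)`_b.

Lemma split_sum_sym N c a b : split_sum N c a b \is symmetric.
Proof.
apply/issymP => s; rewrite raddf_sum /=.
rewrite [RHS](reindex_inj (imset_inj (@perm_inj _ s))) /=.
apply: eq_big => [J|J _]; first by rewrite card_imset //; apply: perm_inj.
have hs i : (s i \in [set s x | x in J]) = (i \in J) by rewrite mem_imset //; apply: perm_inj.
by rewrite rmorphM /=; congr (_ * _); apply: msym_coef_prod_u => i; rewrite hs.
Qed.

(** Expanding the product of the factors x + T u^2, J collects the variables where x is chosen. The
    other c factors give T^c times a square in T, so only even c reach the even exponent 2r, and the
    square contributes its coefficient at (2r - c)/2. *)
Lemma coef_prod_u_double N r :
  (\prod_i conjSq N.+1 i)`_r.*2 =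
  \sum_(c < n.+1 | ~~ odd c && (c <= r.*2)%N)
    \sum_(J : {set 'I_n} | (#|J| + c == n)%N)
      (\prod_(i in J) 'X_i) * ((\prod_(i | i \notin J) conjSq N i)`_(r - c./2)) ^+ 2.
Proof.
under eq_bigr => i _ do rewrite uS.
rewrite bigA_distr coef_sum.
(* Subsets are grouped by c, the size of the complement. *)
rewrite (partition_big (fun J : {set 'I_n} => inord (n - #|J|) : 'I_n.+1) predT) //=.
rewrite [RHS]big_mkcond /=; apply: eq_bigr => c _.
have hJ (J : {set 'I_n}) : (inord (n - #|J|) == c) = (#|J| + c == n)%N.
  have hn : (#|J| <= n)%N by rewrite -[X in (_ <= X)%N]card_ord max_card.
  rewrite -val_eqE /= inordK ?ltnS ?leq_subr //.
  by rewrite -(eqn_add2l #|J|) subnKC // eq_sym.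
under eq_bigl do rewrite hJ.
have hterm (J : {set 'I_n}) : (#|J| + c == n)%N ->
    (\prod_i (if i \in J then ('X_i)%:P else 'X * conjSq N i ^+ 2))`_r.*2 =
    if ~~ odd c && (c <= r.*2)%N then
     (\prod_(i in J) 'X_i) * ((\prod_(i | i \notin J) conjSq N i)`_(r - c./2)) ^+ 2 else 0.
  move=> hc; rewrite (bigID (mem J)) /=.
  rewrite (eq_bigr (fun i => ('X_i)%:P)) => [|i ->//].
  rewrite [X in _ * X](eq_bigr (fun i => 'X * conjSq N i ^+ 2)) => [|i /negPf->//].
  rewrite -rmorph_prod coefCM big_split /= prodr_const prodrXl.
  have -> : #|[pred i | i \notin J]| = c.
    apply/eqP; rewrite -(eqn_add2l #|J|) (eqP hc) -[X in _ == X]card_ord.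
    by rewrite -(cardC (mem J)).
  rewrite ['X^_ * _]mulrC coefMXn coef_sqr_pchar2 ltnNge.
  case: leqP => h; last by rewrite andbF mulr0.
  rewrite andbT /= oddB // odd_double /=; case: ifP => /= ho; rewrite ?mulr0 //.
  by rewrite (_ : (_ - c)./2 = (r - c./2)%N) //; lia.
case: ifP => hc; first by apply: eq_bigr => J /hterm ->; rewrite hc.
by rewrite big1 // => J /hterm ->; rewrite hc.
Qed.



Lemma mul_prodX_sqr_homog e (g : R) : g \is e.-homog ->
  (\prod_i 'X_i) * g ^+ 2 \is (2 * e + n).-homog.
Proof.
move=> hg; rewrite addnC mulnC; apply: dhomogM; last exact: dhomogMn.
rewrite mprodXE dhomogX /= mdeg_sum.
by under eq_bigr do rewrite mdeg1; rewrite sum1_card card_ord.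
Qed.

(** The chi-trick is applied twice: first to all variables, then, for each subset J, to the
    variables in J. The last hypothesis kills the only terms that are not hits. *)
Lemma kameko_hit (M : {pred R}) N m r (g : R) :
  graded_sym_module M -> g \in M -> g \is m.-homog -> (0 < r)%N ->
  (m + r + n < 2 ^ N - 1)%N ->
  (forall j, (0 < j)%N -> (j.*2 <= n)%N -> (j <= r)%N ->
     split_sum N j.*2 (m + r + j) (r - j) = 0) ->
  hit M (2 * (m + r) + n) ((\prod_i 'X_i) * Sqr r g ^+ 2).
Proof.
move=> hM gM hg r_gt0 hN hW; set d := (2 * (m + r) + n)%N.
have [_ mulM symM _] := hM.
have hgd : (\prod_i 'X_i) * Sqr r g ^+ 2 \is d.-homog.
  by apply: mul_prodX_sqr_homog; rewrite addnC; apply: Sqr_homog.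
rewrite -(pihomog_dE hgd) -Sqr_sqr {hgd}.
(* Level N + 1 is taken because the expansion through [uS] lowers the level by one. *)
have hN' : (r.*2 < 2 ^ N.+1 - 1)%N by rewrite expnS; lia.
rewrite (chi_trick xpredT (g ^+ 2) hN') big_ord_recl pihomogD.
apply: hitD => //; last first.
  apply: hit_pihomog_sum => // a _; apply: hit_Sqr => //.
  rewrite expr2; apply: (mulM) => //; last exact: mulM.
  by apply/symM/issymP => s; apply: msym_coef_prod_u.
rewrite Sqr0p subn0 coef_prod_u_double mulr_suml.
apply: hit_pihomog_sum => // c /andP[/even_halfK hc c_le]; set j := (c./2)%N in hc.
rewrite -hc doubleK in c_le *; rewrite leq_double in c_le.
(* For j = 0, J is the whole set, the complementary product is 1, and its coefficient at r > 0 is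
   zero. *)
have [j0|j_gt0] := posnP j.
  rewrite mulr_suml; apply: hit_pihomog_sum => // J.
  rewrite j0 addn0 -[X in _ == X]card_ord => /eqP hJ.
  rewrite [\prod_(i | i \notin J) _]big_pred0 => [|i]; last first.
    by rewrite (subset_cardP hJ (subset_predT _)).
  rewrite coef1 subn0 (gtn_eqF r_gt0) expr0n mulr0 mul0r pihomog0; exact: hit0.
(* The degree of y g, where y is the coefficient attached to J. Thus (y g)^2 = Sq^e(y g), which
   opens the way to the second chi-trick. *)
set e := (m + r + j)%N.
have he : (e < 2 ^ N - 1)%N by have := ltn_ord c; lia.
have -> : (\sum_(J : {set 'I_n} | (#|J| + j.*2 == n)%N)
      (\prod_(i in J) 'X_i) * ((\prod_(i | i \notin J) conjSq N i)`_(r - j)) ^+ 2) * g ^+ 2 =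
  \sum_(a < e.+1) Sqr a (split_sum N j.*2 (e - a) (r - j) * g).
  rewrite mulr_suml; under [RHS]eq_bigr => a _ do rewrite mulr_suml Sqr_sum.
  rewrite exchange_big /=; apply: eq_bigr => J /eqP hJ.
  rewrite -mulrA -exprMn -(@Sqr_top _ e).
    by rewrite (chi_trick (fun i => i \in J) _ he); apply: eq_bigr => a _; rewrite mulrA.
  have hJ' : #|[pred i | i \notin J]| = j.*2.
    apply/eqP; rewrite -(eqn_add2l #|J|) hJ -[X in _ == X]card_ord.
    by rewrite -(cardC (mem J)).
  have -> : e = ((r - j + j.*2) + m)%N by rewrite /e -addnn; lia.
  by rewrite -hJ'; apply: dhomogM (graded_prod_u N (fun i => i \notin J) (r - j)%N) hg.
(* The term a = 0 vanishes by hypothesis; the remaining ones are hits with symmetric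
   coefficients. *)
rewrite big_ord_recl subn0 hW //; last by have := ltn_ord c; lia.
rewrite mul0r Sqrr0 add0r; apply: hit_pihomog_sum => // a _; apply: hit_Sqr => //.
by apply: mulM => //; apply/symM/split_sum_sym.
Qed.

End Kameko.

(** * Vanishing of the split sums in four variables *)

Lemma prod_set2 (S : comNzRingType) (T : finType) (F : T -> S) x y : x != y ->
  \prod_(i in [set x; y]) F i = F x * F y.
Proof. by move=> xy; rewrite big_setU1 ?big_set1 ?inE. Qed.

Section FourVariables.
Local Notation R := {mpoly 'F_2[4]}.

(** The powers of T in [conjSq] have exponents 2^k - 1 only. *)
Lemma coef_u_mul_eq0 n N (x y : 'I_n) e :
  (forall a b, e <> (2 ^ a - 1) + (2 ^ b - 1))%N ->
  (conjSq N x * conjSq N y)`_e = 0 :> {mpoly 'F_2[n]}.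
Proof.
move=> he; rewrite /conjSq big_distrlr /= coef_sum big1 // => a _.
rewrite coef_sum big1 // => b _; rewrite mulrACA -exprD -rmorphM /= coefCM coefXn.
by case: eqP => [/he|_]; rewrite ?mulr0.
Qed.

Lemma prod_in_card0 (F : 'I_4 -> {poly R}) (J : {set 'I_4}) : #|J| = 0%N ->
  \prod_(i in J) F i = 1.
Proof. by move/eqP; rewrite cards_eq0 => /eqP->; rewrite big_set0. Qed.

Lemma kameko_step (M : {pred R}) d f : graded_sym_module M ->
  (forall a b, d.+1 <> (2 ^ a - 1) + (2 ^ b - 1))%N ->
  hit M d f -> hit M (2 * d + 4) ((\prod_i 'X_i) * f ^+ 2).
Proof.
move=> hM hd [g [hg ->]].
rewrite sqr_sum_pchar2 ?pchar2_mpoly // mulr_sumr big_seq.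
apply: hit_sum => // r; rewrite mem_index_iota ltnS => hr.
have [gM ghom] := hg r hr; have /andP[r_gt0 rd] := hr.
(* The level d + 5 is large enough because k < 2^k. *)
have hN : (d - r + r + 4 < 2 ^ (d + 5) - 1)%N.
  by have := ltn_expl (d + 5) (ltnSn 1); rewrite subnK //; lia.
have := @kameko_hit 4 M _ _ _ _ hM gM ghom r_gt0 hN; rewrite subnK //; apply.
move=> j j_gt0 hj jr; rewrite /split_sum big1 // => J /eqP hJ.
(* For j = 1 the pair J is evaluated at d + 1, which the hypothesis excludes; for j = 2, J is empty
   and 1 has no coefficient at d + 2. *)
have [j1|j2] : j = 1%N \/ j = 2%N by lia.
  have /cards2P [x [y [xy ->]]] : #|J| == 2%N by apply/eqP; move: hJ; rewrite j1; lia.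
  rewrite prod_set2 // coef_u_mul_eq0 ?mul0r // => a b.
  by rewrite j1 addn1; apply: hd.
rewrite prod_in_card0; last by move: hJ; rewrite j2; lia.
by rewrite coef1 addn_eq0 [j == _]gtn_eqF // andbF mul0r.
Qed.

(** The shape of [conjSq 4], with generic coefficients so that products can be expanded cheaply. *)
Definition quad_poly (S : comNzRingType) (a b c d : S) : {poly S} :=
  a%:P + b%:P * 'X + c%:P * 'X^3 + d%:P * 'X^7.

Lemma coef_quad_poly (S : comNzRingType) (a b c d : S) k :
  (quad_poly a b c d)`_k = nth 0 [:: a; b; 0; c; 0; 0; 0; d] k.
Proof.
rewrite /quad_poly !coefD !coefCM coefX !coefXn coefC.
by case: k => [|[|[|[|[|[|[|[|k]]]]]]]] /=;
  rewrite ?nth_nil !(mulr0, mulr1, add0r, addr0).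
Qed.

Lemma coef3_quad_mul (S : comNzRingType) (a b c d a' b' c' d' : S) :
  (quad_poly a b c d * quad_poly a' b' c' d')`_3 = a * c' + c * a'.
Proof.
rewrite coefM !big_ord_recl big_ord0 !coef_quad_poly /=.
by rewrite !(mulr0, mul0r, add0r, addr0).
Qed.

Lemma coef10_quad_mul (S : comNzRingType) (a b c d a' b' c' d' : S) :
  (quad_poly a b c d * quad_poly a' b' c' d')`_10 = c * d' + d * c'.
Proof.
rewrite coefM !big_ord_recl big_ord0 !coef_quad_poly /=.
by rewrite !(mulr0, mul0r, add0r, addr0).
Qed.

Lemma u4E (x : 'I_4) :
  conjSq 4 x = quad_poly 'X_x ('X_x ^+ 2) ('X_x ^+ 4) ('X_x ^+ 8) :> {poly R}.
Proof. by rewrite /conjSq !big_ord_recl big_ord0 /= !expr1 !expr0 mulr1 addr0 !addrA. Qed.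

Let o (k : nat) : 'I_4 := inord k.

Lemma big_set2_ord4 (V : nmodType) (F : {set 'I_4} -> V) :
  \sum_(J : {set 'I_4} | #|J| == 2) F J =
  F [set o 0; o 1] + F [set o 0; o 2] + F [set o 0; o 3] +
  F [set o 1; o 2] + F [set o 1; o 3] + F [set o 2; o 3].
Proof.
pose ps := [:: (0, 1); (0, 2); (0, 3); (1, 2); (1, 3); (2, 3)]%N.
have hps : {in ps, forall p, [/\ (p.1 < 4)%N, (p.2 < 4)%N & p.1 != p.2]}.
  by move=> p hp; apply/and3P; move: p hp; apply/allP.
pose s := [seq [set o p.1; o p.2] | p <- ps].
have o_neq p : p \in ps -> o p.1 != o p.2.
  by move=> /hps[? ? ?]; rewrite -val_eqE /= !inordK.
have uniq_s : uniq s.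
  (* The binary code of a subset separates the six pairs by computation; as there are binomial(4,2)
     = 6 pairs in all, the list is complete. *)
  pose h (J : {set 'I_4}) := (\sum_(i in J) 2 ^ i)%N.
  apply: (@map_uniq _ _ h); rewrite /s -map_comp.
  suff -> : [seq (h \o (fun p => [set o p.1; o p.2])) p | p <- ps] =
    [seq 2 ^ p.1 + 2 ^ p.2 | p <- ps]%N by [].
  apply/eq_in_map => p hp; have [? ? _] := hps p hp.
  by rewrite /= /h big_setU1 ?big_set1 ?inE ?o_neq //= !inordK.
have [_ hs] : (size s = size (enum [set J : {set 'I_4} | #|J| == 2])) *
    (s =i enum [set J : {set 'I_4} | #|J| == 2]).
  apply: uniq_min_size => // [J /mapP[p hp ->]|].
    by rewrite mem_enum inE cards2 o_neq.
  by rewrite -cardE card_draws card_ord.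
transitivity (\sum_(J <- s) F J); last by rewrite !big_cons big_nil addr0 !addrA.
by rewrite big_uniq //; apply: eq_bigl => J; rewrite hs mem_enum inE.
Qed.

(** Over the exponents 0, 1, 3, 7 the only splittings are 10 = 3 + 7 and 3 = 0 + 3. The resulting
    monomials have exponents 8, 4, 4, 1 in some order, and each comes from exactly two J: the
    position of 8 with either position of 4. *)
Lemma split_sum_base : split_sum 4 4 2 10 3 = 0 :> R.
Proof.
have E (x y z t : 'I_4) : uniq [:: x; y; z; t] ->
    (\prod_(i in [set x; y]) conjSq 4 i)`_10 * (\prod_(i | i \notin [set x; y]) conjSq 4 i)`_3 =
    ('X_x ^+ 4 * 'X_y ^+ 8 + 'X_x ^+ 8 * 'X_y ^+ 4) *
    ('X_z * 'X_t ^+ 4 + 'X_z ^+ 4 * 'X_t) :> R.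
  move=> huniq.
  have hall : [:: x; y; z; t] =i 'I_4.
    by apply/subset_cardP; rewrite ?(card_uniqP huniq) ?card_ord //; apply/subsetP.
  have hN i : (i \notin [set x; y]) = (i \in [set z; t]).
    have := hall i; move: huniq; rewrite !inE /= !inE.
    rewrite !negb_or => /and4P[/and3P[xy xz xt] /andP[yz yt] zt _].
    have [->|ix] := eqVneq i x; first by rewrite (negPf xz) (negPf xt).
    have [->|iy] := eqVneq i y; first by rewrite (negPf yz) (negPf yt).
    by move=> /= ->.
  have [xy zt] : x != y /\ z != t.
    by move: huniq; rewrite /= !inE !negb_or => /and4P[/and3P[? _ _] _ ? _].
  rewrite (eq_bigl _ _ hN) !prod_set2 //.
  by rewrite !u4E; congr (_ * _); [exact: coef10_quad_mul|exact: coef3_quad_mul].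
rewrite /split_sum (eq_bigl (fun J : {set 'I_4} => #|J| == 2)); last first.
  by move=> J; exact: (eqn_add2r 2 #|J| 2).
have hu s : uniq s -> all (fun k => k < 4)%N s -> uniq (map o s).
  move=> us /allP hs; rewrite map_inj_in_uniq // => a b /hs ha /hs hb /(congr1 val) /=.
  by rewrite !inordK.
rewrite big_set2_ord4.
rewrite (E _ _ (o 2) (o 3)) ?(hu [:: 0; 1; 2; 3]%N) //.
rewrite (E _ _ (o 1) (o 3)) ?(hu [:: 0; 2; 1; 3]%N) //.
rewrite (E _ _ (o 1) (o 2)) ?(hu [:: 0; 3; 1; 2]%N) //.
rewrite (E _ _ (o 0) (o 3)) ?(hu [:: 1; 2; 0; 3]%N) //.
rewrite (E _ _ (o 0) (o 2)) ?(hu [:: 1; 3; 0; 2]%N) //.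
rewrite (E _ _ (o 0) (o 1)) ?(hu [:: 2; 3; 0; 1]%N) //.
move: ('X_(o 0)) ('X_(o 1)) ('X_(o 2)) ('X_(o 3)) => a b c d.
rewrite [LHS](_ : _ = (a ^+ 8 * b ^+ 4 * c ^+ 4 * d + a ^+ 8 * b ^+ 4 * c * d ^+ 4 +
  a ^+ 8 * b * c ^+ 4 * d ^+ 4 + b ^+ 8 * a ^+ 4 * c ^+ 4 * d +
  b ^+ 8 * a ^+ 4 * c * d ^+ 4 + b ^+ 8 * a * c ^+ 4 * d ^+ 4 +
  c ^+ 8 * a ^+ 4 * b ^+ 4 * d + c ^+ 8 * a ^+ 4 * b * d ^+ 4 +
  c ^+ 8 * a * b ^+ 4 * d ^+ 4 + d ^+ 8 * a ^+ 4 * b ^+ 4 * c +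
  d ^+ 8 * a ^+ 4 * b * c ^+ 4 + d ^+ 8 * a * b ^+ 4 * c ^+ 4) *+ 2).
  by rewrite (mulrn_pchar (pchar2_mpoly 4)).
by ring.
Qed.

End FourVariables.

(** * Orbits of monomials and monomial symmetric functions *)

Section Monomials.
Context (n : nat).
Local Notation R := {mpoly 'F_2[n]}.
Implicit Types a b : 'X_{1..n}.

Definition orbit_seq a : seq 'X_{1..n} :=
  undup [seq [multinom a (s i) | i < n] | s : 'S_n].

Lemma mem_orbit_seq a b :
  reflect (exists s : 'S_n, b = [multinom a (s i) | i < n]) (b \in orbit_seq a).
Proof.
rewrite mem_undup; apply: (iffP mapP) => [[s _ ->]|[s ->]]; first by exists s.
by exists s; rewrite ?mem_enum.
Qed.

Lemma mdeg_orbit a b : b \in orbit_seq a -> mdeg b = mdeg a.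
Proof. by move=> /mem_orbit_seq[s ->]; apply: mdeg_mperm. Qed.

Lemma monomial_symE a : monomial_sym a = \sum_(b <- orbit_seq a) 'X_[b].
Proof. by []. Qed.

Lemma monomial_sym_homog a : monomial_sym a \is (mdeg a).-homog.
Proof.
rewrite monomial_symE big_seq; apply: rpred_sum => b /mdeg_orbit <-.
by rewrite dhomogX.
Qed.

Lemma monomial_sym_sym a : monomial_sym a \is symmetric.
Proof.
apply/issymP => s; rewrite monomial_symE raddf_sum /=.
under eq_bigr do rewrite msymX.
rewrite -(big_map (fun b => [multinom b ((s^-1)%g i) | i < n]) predT (fun b => 'X_[b])).
apply: perm_big; apply: uniq_perm; rewrite ?undup_uniq //.
  by rewrite map_inj_uniq ?undup_uniq //; apply: mperm_inj.
move=> b; apply/mapP/mem_orbit_seq => [[c /mem_orbit_seq[s' ->] ->]|[s' ->]].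
  by exists (s^-1 * s')%g; apply/mnmP => i; rewrite !mnmE permM.
exists [multinom a ((s * s')%g i) | i < n]; first by apply/mem_orbit_seq; exists (s * s')%g.
by apply/mnmP => i; rewrite !mnmE permM permKV.
Qed.

(** Injectivity ensures that distinct monomials of the orbit stay distinct, so no multiplicities
    appear. *)
Lemma monomial_sym_map (f : nat -> nat) a : injective f ->
  monomial_sym [multinom f (a i) | i < n] =
  \sum_(b <- orbit_seq a) 'X_[[multinom f (b i) | i < n]].
Proof.
move=> f_inj; pose F b := [multinom f (b i) | i < n].
have F_inj : injective F.
  by move=> b c /mnmP h; apply/mnmP => i; have := h i; rewrite !mnmE; apply: f_inj.
rewrite monomial_symE -(big_map F predT (fun b => 'X_[b])) -undup_map_inj // -map_comp.
congr (\sum_(b <- undup _) _); apply: eq_map => s; apply/mnmP => i.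
by rewrite !mnmE.
Qed.

Lemma mpolyX_doubleS a :
  'X_[[multinom (a i).*2.+1 | i < n]] = (\prod_i 'X_i) * 'X_[a] ^+ 2 :> R.
Proof.
rewrite mpolyXn mprodXE -mpolyXD; congr 'X_[_]; apply/mnmP => i.
by rewrite mnmDE mulmnE mnmE mnm_sumE (bigD1 i) //= big1 ?mnm1E ?eqxx => [|j /negPf ji];
  rewrite ?mnm1E ?ji //; lia.
Qed.

Lemma monomial_sym_doubleS a :
  monomial_sym [multinom (a i).*2.+1 | i < n] = (\prod_i 'X_i) * monomial_sym a ^+ 2.
Proof.
rewrite (@monomial_sym_map (fun k => k.*2.+1)) => [|k l [/double_inj]//].
rewrite monomial_symE sqr_sum_pchar2 ?pchar2_mpoly // mulr_sumr.
by apply: eq_bigr => b _; apply: mpolyX_doubleS.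
Qed.

Lemma coefS_mul_linear (S : comNzRingType) (p : {poly S}) (a b : S) k :
  (p * (a%:P + b%:P * 'X))`_k.+1 = p`_k.+1 * a + p`_k * b.
Proof. by rewrite mulrDr mulrA coefD coefMX !coefMC. Qed.

(** With p = xy, the Cartan formula leaves Sq^4(p^2) z + Sq^3(p^2) z^2. Odd squares vanish on p^2,
    and Sq^4(p^2) = (Sq^2 p)^2 = p^4. *)
Lemma Sqr4_sqr_mul (x y z : 'I_n) :
  Sqr 4 ('X_x ^+ 2 * 'X_y ^+ 2 * 'X_z) = 'X_x ^+ 4 * 'X_y ^+ 4 * 'X_z :> R.
Proof.
set p : R := 'X_x * 'X_y.
have hp : p \is 2.-homog.
  exact: (dhomogM (dhomogXi x) (dhomogXi y)).
have Sq2 : (Sqt p)`_2 = p ^+ 2 by rewrite -SqrE; apply: Sqr_top.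
have c4 : (Sqt p ^+ 2)`_4 = 'X_x ^+ 4 * 'X_y ^+ 4.
  by rewrite (coef_sqr_pchar2 _ 4) Sq2 -exprM exprMn.
have c3 : (Sqt p ^+ 2)`_3 = 0 by apply: (coef_sqr_pchar2 _ 3).
have -> : 'X_x ^+ 2 * 'X_y ^+ 2 * 'X_z = p ^+ 2 * 'X_z by rewrite exprMn.
have hSqt : Sqt (p ^+ 2 * 'X_z) = Sqt p ^+ 2 * (('X_z)%:P + ('X_z ^+ 2)%:P * 'X).
  by rewrite rmorphM rmorphXn /= SqtX.
rewrite SqrE hSqt; apply: etrans (coefS_mul_linear _ _ _ 3) _.
by rewrite c4 c3 mul0r addr0.
Qed.

End Monomials.

(** * The starting monomial x^(2,2,1,0) *)

Section Base.
Local Notation R := {mpoly 'F_2[4]}.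

Definition mu : 'X_{1..4} := [multinom of [:: 2; 2; 1; 0]%N].

Lemma mdeg_mu : mdeg mu = 5%N.
Proof. by rewrite mdegE !big_ord_recl big_ord0 !multinomE !(tnth_nth 0%N). Qed.

(** One formula covers [mu] (e = 1) and its entrywise square (2,2,1,0) -> (4,4,1,0) (e = 2). Writing
    Sq^4 as the injective map k -> k^2 on exponents lets it pass through orbit sums. *)
Lemma mpolyX_exp_mu (s : 'S_4) e : (0 < e)%N ->
  let x k := 'X_((s^-1)%g k) : R in
  'X_[[multinom (mu (s i) ^ e)%N | i < 4]] =
  x ord0 ^+ (2 ^ e) * x (lift ord0 ord0) ^+ (2 ^ e) * x (lift ord0 (lift ord0 ord0)).
Proof.
move=> e_gt0 x; have hs j : s ((s^-1)%g j) = j by rewrite permKV.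
rewrite mpolyXE_id (reindex_inj (@perm_inj _ s^-1%g)) /=.
under eq_bigr => j _ do rewrite mnmE hs multinomE.
by rewrite !big_ord_recl big_ord0 !(tnth_nth 0%N) /= exp1n exp0n // expr0 expr1 !mulr1 !mulrA.
Qed.

Lemma Sqr4_mu b : b \in orbit_seq mu ->
  Sqr 4 'X_[b] = 'X_[[multinom (b i ^ 2)%N | i < 4]] :> R.
Proof.
move=> /mem_orbit_seq[s ->].
have h1 : [multinom mu (s i) | i < 4] = [multinom (mu (s i) ^ 1)%N | i < 4].
  by apply/mnmP => i; rewrite !mnmE.
have h2 : [multinom ([multinom mu (s j) | j < 4] i ^ 2)%N | i < 4] =
    [multinom (mu (s i) ^ 2)%N | i < 4].
  by apply/mnmP => i; rewrite !mnmE.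
rewrite h2 h1 !mpolyX_exp_mu //; exact: Sqr4_sqr_mul.
Qed.

End Base.

(** * Arithmetic of lambda_t and the two hit statements *)

Lemma lambda0E : lambda 0 = [multinom ([multinom (mu j ^ 2)%N | j < 4] i).*2.+1 | i < 4].
Proof. by apply/mnmP => -[[|[|[|[|i]]]] hi] //; rewrite !mnmE. Qed.

Lemma lambdaSE t : lambda t.+1 = [multinom (lambda t i).*2.+1 | i < 4].
Proof.
have T_gt0 : (0 < 2 ^ t)%N by rewrite expn_gt0.
apply/mnmP => -[[|[|[|[|i]]]] hi] //; rewrite !mnmE /= !multinomE !(tnth_nth 0%N) /=;
  rewrite ?expnD ?expnS; move: (2 ^ t)%N T_gt0 => T hT; lia.
Qed.

Lemma mdeg4 (b : 'X_{1..4}) :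
  mdeg b = (b (inord 0) + b (inord 1) + b (inord 2) + b (inord 3))%N.
Proof.
rewrite mdegE !big_ord_recl big_ord0 addn0 !addnA.
by congr (b _ + b _ + b _ + b _)%N; apply: val_inj; rewrite /= inordK.
Qed.

Lemma mdeg_lambda t : mdeg (lambda t) = d_ t.
Proof.
have T_gt0 : (0 < 2 ^ t)%N by rewrite expn_gt0.
rewrite mdeg4 !multinomE !(tnth_nth 0%N) /= !inordK //= /d_ !expnD.
by move: (2 ^ t)%N T_gt0 => T hT; lia.
Qed.

Lemma pow2_neq_13pow2_subn1 t a : (2 ^ a <> 13 * 2 ^ t - 1)%N.
Proof.
case: t => [|t].
  by rewrite expn0 muln1; do 4 (case: a => [//|a]); rewrite !expnS; lia.
have T_gt0 : (0 < 2 ^ t)%N by rewrite expn_gt0.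
case: a => [|a]; rewrite !expnS; last by lia.
by rewrite expn0; lia.
Qed.

(** The right side is odd, so one summand is 1 and the other would be twice 13*2^t - 1, which is 12
    for t = 0 and odd, greater than 1, otherwise. *)
Lemma pow2_add_neq t a b : (2 ^ a + 2 ^ b <> 26 * 2 ^ t - 1)%N.
Proof.
have T_gt0 : (0 < 2 ^ t)%N by rewrite expn_gt0.
wlog : a b / (a <= b)%N => [hw|].
  by case: (leqP a b) => [|/ltnW]; [|rewrite addnC]; apply: hw.
have h k : (2 ^ k.+1 + 1 <> 26 * 2 ^ t - 1)%N.
  by have := @pow2_neq_13pow2_subn1 t k; rewrite expnS; lia.
case: a b => [|a] [|b] // _; rewrite ?expn0.
- by lia.
- by rewrite addnC; apply: h.
- by rewrite !expnS; lia.
Qed.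

Lemma hit_iter_kameko (M : {pred {mpoly 'F_2[4]}}) (g : {mpoly 'F_2[4]})
    (f : nat -> {mpoly 'F_2[4]}) :
  graded_sym_module M -> g \in M -> g \is 5.-homog ->
  f 0%N = (\prod_i 'X_i) * Sqr 4 g ^+ 2 ->
  (forall t, f t.+1 = (\prod_i 'X_i) * f t ^+ 2) ->
  forall t, hit M (d_ t) (f t).
Proof.
move=> hM gM hg f0 fS; elim=> [|t IH].
  (* Here m = 5, r = 4, d_0 = 22 = 2(5 + 4) + 4, and level 4 suffices as 5 + 4 + 4 < 15. The case j
     = 1 is [split_sum_base]; for j = 2, J is empty. *)
  rewrite f0; apply: (@kameko_hit 4 M 4 5 4) => // -[|[|[|j]]] // _ _ _.
    exact: split_sum_base.
  rewrite /split_sum big1 // => J /eqP hJ.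
  by rewrite prod_in_card0 ?coef1 ?mul0r //; lia.
have T_gt0 : (0 < 2 ^ t)%N by rewrite expn_gt0.
rewrite fS (_ : d_ t.+1 = 2 * d_ t + 4)%N; last by rewrite /d_ expnS; lia.
apply: kameko_step => // a b; rewrite /d_ => hab.
(* Here d_t + 1 = 26*2^t - 3 would equal 2^a + 2^b - 2. *)
apply: (@pow2_add_neq t a b).
have : (0 < 2 ^ a)%N by rewrite expn_gt0.
have : (0 < 2 ^ b)%N by rewrite expn_gt0.
move: (2 ^ a)%N (2 ^ b)%N (2 ^ t)%N T_gt0 hab; lia.
Qed.

Lemma hit_mpolyX_lambda t : hit (P 4) (d_ t) 'X_[lambda t].
Proof.
move: t; apply: (hit_iter_kameko (@graded_sym_moduleP 4) (g := 'X_[mu])) => //.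
- by rewrite dhomogX /= mdeg_mu.
- rewrite lambda0E mpolyX_doubleS -Sqr4_mu //.
  by apply/mem_orbit_seq; exists 1%g; apply/mnmP => i; rewrite mnmE perm1.
- by move=> t; rewrite lambdaSE mpolyX_doubleS.
Qed.

Lemma hit_monomial_sym_lambda t : hit (B 4) (d_ t) (monomial_sym (lambda t)).
Proof.
move: t; apply: (hit_iter_kameko (@graded_sym_moduleB 4) (g := monomial_sym mu)).
- exact: monomial_sym_sym.
- by rewrite -mdeg_mu; apply: monomial_sym_homog.
- rewrite lambda0E monomial_sym_doubleS; congr (_ * _ ^+ 2).
  rewrite (@monomial_sym_map _ (fun k => k ^ 2)%N) => [|k l /eqP]; last first.
    by rewrite eqn_sqr => /eqP.
  rewrite monomial_symE Sqr_sum big_seq [RHS]big_seq.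
  by apply: eq_bigr => b hb; rewrite Sqr4_mu.
- by move=> t; rewrite lambdaSE monomial_sym_doubleS.
Qed.

(** * Weight sequences and the minimal spike *)

Section Weights.
Context (n : nat).
Implicit Types a b : 'X_{1..n}.

Lemma weight_doubleS0 a : weight [multinom (a i).*2.+1 | i < n] 0 = n.
Proof.
rewrite /weight; under eq_bigr => i _ do rewrite mnmE expn0 divn1 /= odd_double.
by rewrite sum1_card card_ord.
Qed.

Lemma weight_doubleSS a j :
  weight [multinom (a i).*2.+1 | i < n] j.+1 = weight a j.
Proof.
rewrite /weight; apply: eq_bigr => i _; rewrite mnmE expnS divnMA divn2.
by rewrite -[_.*2.+1]/(true + _.*2)%N half_bit_double.
Qed.

Lemma lex_lt_doubleS a b : lex_lt (weight a) (weight b) ->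
  lex_lt (weight [multinom (a i).*2.+1 | i < n])
         (weight [multinom (b i).*2.+1 | i < n]).
Proof.
move=> [j [h1 h2]]; exists j.+1; split=> [[|k] hk|].
- by rewrite !weight_doubleS0.
- by rewrite !weight_doubleSS h1.
- by rewrite !weight_doubleSS.
Qed.

End Weights.

Definition min_spike t : 'X_{1..4} :=
  [multinom of [:: 16 * 2 ^ t - 1; 8 * 2 ^ t - 1; 2 ^ t - 1; 2 ^ t - 1]%N].

Lemma min_spikeSE t : min_spike t.+1 = [multinom (min_spike t i).*2.+1 | i < 4].
Proof.
have T_gt0 : (0 < 2 ^ t)%N by rewrite expn_gt0.
apply/mnmP => -[[|[|[|[|i]]]] hi] //; rewrite !mnmE /= !multinomE !(tnth_nth 0%N) /=;
  rewrite !expnS; move: (2 ^ t)%N T_gt0 => T hT; lia.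
Qed.

Lemma mdeg_min_spike t : mdeg (min_spike t) = d_ t.
Proof.
have T_gt0 : (0 < 2 ^ t)%N by rewrite expn_gt0.
rewrite mdeg4 !multinomE !(tnth_nth 0%N) /= !inordK //= /d_.
by move: (2 ^ t)%N T_gt0 => T hT; lia.
Qed.

Lemma spike_min_spike t : spike (min_spike t).
Proof.
move=> [[|[|[|[|i]]]] hi] //; rewrite multinomE (tnth_nth 0%N) /=.
- by exists (4 + t)%N; rewrite expnD.
- by exists (3 + t)%N; rewrite expnD.
- by exists t.
- by exists t.
Qed.

Lemma weight4 (b : 'X_{1..4}) j :
  weight b j = (odd (b (inord 0) %/ 2 ^ j) + odd (b (inord 1) %/ 2 ^ j) +
                odd (b (inord 2) %/ 2 ^ j) + odd (b (inord 3) %/ 2 ^ j))%N.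
Proof.
rewrite /weight !big_ord_recl big_ord0 addn0 !addnA.
by congr (odd (b _ %/ _) + odd (b _ %/ _) + odd (b _ %/ _) + odd (b _ %/ _))%N;
  apply: val_inj; rewrite /= inordK.
Qed.

Lemma pow2_add_eq12 a b : (2 ^ a + 2 ^ b = 12)%N ->
  (a = 3 /\ b = 2) \/ (a = 2 /\ b = 3).
Proof.
have ha : (a < 4)%N \/ (16 <= 2 ^ a)%N.
  by case: (ltnP a 4) => h; [left|right; rewrite -[16%N]/(2 ^ 4)%N leq_exp2l].
have hb : (b < 4)%N \/ (16 <= 2 ^ b)%N.
  by case: (ltnP b 4) => h; [left|right; rewrite -[16%N]/(2 ^ 4)%N leq_exp2l].
case: ha => [ha|]; last by lia.
case: hb => [hb|]; last by lia.
case: a ha => [|[|[|[|a]]]] // _; case: b hb => [|[|[|[|b]]]] // _; by auto.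
Qed.

(** By parity the number of zero r's is even, and four of them give too small a sum. Two of them
    leave 2^a + 2^b + 1 = 13*2^t after halving, which forces t = 0 and 12 = 8 + 4. *)
Lemma spike_exponents t r0 r1 r2 r3 :
  (2 ^ r0 + 2 ^ r1 + 2 ^ r2 + 2 ^ r3 = 26 * 2 ^ t)%N ->
  [&& 0 < r0, 0 < r1, 0 < r2 & 0 < r3]%N \/
  t = 0%N /\ perm_eq [:: r0; r1; r2; r3] [:: 4; 3; 0; 0]%N.
Proof.
have two a b : (2 ^ a + 2 ^ b + 1 = 13 * 2 ^ t)%N ->
    t = 0%N /\ ((a = 3 /\ b = 2) \/ (a = 2 /\ b = 3))%N.
  case: t => [|t] h; first by split=> //; apply: pow2_add_eq12; rewrite expn0 in h; lia.
  by exfalso; apply: (@pow2_add_neq t a b); rewrite expnS in h; lia.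
have T_gt0 : (0 < 2 ^ t)%N by rewrite expn_gt0.
case: r0 r1 r2 r3 => [|r0] [|r1] [|r2] [|r3] h; try (by left); right;
  rewrite ?expn0 ?expnS in h; try (exfalso; lia).
- by have [|-> [[-> ->]|[-> ->]]] := two r2 r3; first lia.
- by have [|-> [[-> ->]|[-> ->]]] := two r1 r3; first lia.
- by have [|-> [[-> ->]|[-> ->]]] := two r1 r2; first lia.
- by have [|-> [[-> ->]|[-> ->]]] := two r0 r3; first lia.
- by have [|-> [[-> ->]|[-> ->]]] := two r0 r2; first lia.
- by have [|-> [[-> ->]|[-> ->]]] := two r0 r1; first lia.
Qed.

Lemma sum_pow2_spike t (b : 'X_{1..4}) r0 r1 r2 r3 :
  b (inord 0) = (2 ^ r0 - 1)%N -> b (inord 1) = (2 ^ r1 - 1)%N ->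
  b (inord 2) = (2 ^ r2 - 1)%N -> b (inord 3) = (2 ^ r3 - 1)%N ->
  mdeg b = d_ t -> (2 ^ r0 + 2 ^ r1 + 2 ^ r2 + 2 ^ r3 = 26 * 2 ^ t)%N.
Proof.
move=> h0 h1 h2 h3; rewrite mdeg4 h0 h1 h2 h3 /d_.
have p k : (0 < 2 ^ k)%N by rewrite expn_gt0.
by move: (p r0) (p r1) (p r2) (p r3) (p t); lia.
Qed.

Lemma odd_pow2_subn1 r : (0 < r)%N -> odd (2 ^ r - 1).
Proof. by case: r => // r _; rewrite oddB ?expn_gt0 // oddX. Qed.

Lemma ord4_ind (Q : 'I_4 -> Prop) :
  Q (inord 0) -> Q (inord 1) -> Q (inord 2) -> Q (inord 3) -> forall i, Q i.
Proof.
move=> Q0 Q1 Q2 Q3 i; rewrite -[i]inord_val.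
by case: i => [[|[|[|[|i]]]] hi].
Qed.

(** For t = 0 a spike is a permutation of (15,7,0,0) or has first weight 4 > 2. For larger t all
    exponents are odd, and k -> (k - 1)/2 reduces to t - 1 while shifting the weights. *)
Lemma weight_min_spike t (b : 'X_{1..4}) : spike b -> mdeg b = d_ t ->
  weight b =1 weight (min_spike t) \/ lex_lt (weight (min_spike t)) (weight b).
Proof.
elim: t b => [|t IH] b hb hdeg;
  have [[r0 h0] [r1 h1] [r2 h2] [r3 h3]] :=
    And4 (hb (inord 0)) (hb (inord 1)) (hb (inord 2)) (hb (inord 3));
  have := spike_exponents (sum_pow2_spike h0 h1 h2 h3 hdeg).
  case=> [|[_ hperm]].
    move=> /and4P[q0 q1 q2 q3]; right; exists 0%N; split=> //.
    rewrite !weight4 h0 h1 h2 h3 !expn0 !divn1 !odd_pow2_subn1 //.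
    by rewrite !multinomE !(tnth_nth 0%N) /= !inordK.
  left=> j; rewrite !weight4 h0 h1 h2 h3 !multinomE !(tnth_nth 0%N) /= !inordK //=.
  have : (\sum_(r <- [:: r0; r1; r2; r3]) odd ((2 ^ r - 1) %/ 2 ^ j) =
      \sum_(r <- [:: 4; 3; 0; 0]) odd ((2 ^ r - 1) %/ 2 ^ j))%N by apply: perm_big.
  by rewrite !big_cons !big_nil !addn0 !addnA.
case=> [/and4P[q0 q1 q2 q3]|[]//].
have b_odd i : odd (b i).
  move: i; apply: ord4_ind; rewrite ?h0 ?h1 ?h2 ?h3; exact: odd_pow2_subn1.
pose c := [multinom (b i)./2 | i < 4].
have bE : b = [multinom (c i).*2.+1 | i < 4].
  apply/mnmP => i; rewrite !mnmE -[LHS]odd_double_half.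
  by rewrite b_odd.
have hc : spike c.
  move=> i; have [r hr] := hb i; have := b_odd i; rewrite mnmE.
  case: r hr => [|r] ->  // _.
  exists r; rewrite expnS mul2n; have : (0 < 2 ^ r)%N by rewrite expn_gt0.
  by move: (2 ^ r)%N => k; lia.
have hcdeg : mdeg c = d_ t.
  move: hdeg; rewrite bE !mdeg4 !mnmE /d_ expnS.
  have : (0 < 2 ^ t)%N by rewrite expn_gt0.
  by lia.
rewrite min_spikeSE bE; have [h|h] := IH c hc hcdeg; [left|right].
  case=> [|j]; first by rewrite !weight_doubleS0.
  by rewrite !weight_doubleSS.
exact: lex_lt_doubleS.
Qed.

(** At t = 0 the first weights are 2 for (15,7,0,0) and 4 for (9,9,3,1); each later step prepends a
    common entry 4. *)
Lemma lex_lt_min_spike_lambda t : lex_lt (weight (min_spike t)) (weight (lambda t)).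
Proof.
elim: t => [|t IH]; last by rewrite min_spikeSE lambdaSE; apply: lex_lt_doubleS.
exists 0%N; split=> //; rewrite lambda0E weight_doubleS0.
by rewrite weight4 !multinomE !(tnth_nth 0%N) /= !inordK.
Qed.

Theorem theorem1p3 (t : nat) :
  [/\ mdeg (lambda t) = d_ t,
      hit (P 4) (d_ t) 'X_[lambda t],
      hit (B 4) (d_ t) (monomial_sym (lambda t))
    & exists w : nat -> nat,
        is_weight_min 4 (d_ t) w /\ lex_lt w (weight (lambda t))].
Proof.
split; [exact: mdeg_lambda|exact: hit_mpolyX_lambda|exact: hit_monomial_sym_lambda|].
exists (weight (min_spike t)); split; last exact: lex_lt_min_spike_lambda.
split; last by move=> b; apply: weight_min_spike.
by exists (min_spike t); split; [exact: spike_min_spike|exact: mdeg_min_spike|].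
Qed.
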